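(* Let $\beta>0$ and $t\ge 1$. Let $G$ be a bipartite graph with bipartition $(U,W)$ such that $|W|\ge t|U|$, and let $n=|U|+|W|$. If $G$ is a weakly $(n,\beta)$-graph, then $$\alpha'(G)\ge \min\left\{t(1-2\beta^2),\,1\right\}\cdot |U|.$$
   Context: All graphs are finite, simple and nonempty. $\alpha'(G)$ denotes the matching number. For $\beta>0$, a graph $G$ on $n$ vertices is a weakly $(n,\beta)$-graph if $\frac{|X||Y|}{(n-|X|)(n-|Y|)}\le\beta^2$ for every pair of disjoint proper subsets $X,Y$ of $V(G)$ with no edge between $X$ and $Y$. *)

(* Defs.v *)
From mathcomp Require Import all_boot all_order all_algebra.

Set Implicit Arguments.
Unset Strict Implicit.
Unset Printing Implicit Defensive.

Import Order.TTheory GRing.Theory Num.Theory.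
Local Open Scope ring_scope.

(* A simple graph is a symmetric irreflexive relation on a finType; these two
   properties are hypotheses wherever they are needed. *)

Definition edge_set (V : finType) (e : rel V) : {set {set V}} :=
  [set [set p.1; p.2] | p : V * V & e p.1 p.2].

Definition is_matching (V : finType) (e : rel V) (M : {set {set V}}) : bool :=
  (M \subset edge_set e) && trivIset M.

Definition matching_number (V : finType) (e : rel V) : nat :=
  (\max_(M : {set {set V}} | is_matching e M) #|M|)%N.

(* U and W may be empty, so this is not [partition [set U; W] setT]. *)
Definition bipartition (V : finType) (e : rel V) (U W : {set V}) : Prop :=
  [/\ U :|: W = [set: V],
      [disjoint U & W] &
      forall x y, e x y ->
        (x \in U) && (y \in W) || (x \in W) && (y \in U)].

(* The denominator is nonzero because X and Y are proper subsets. *)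
Definition weakly_nb_graph (R : realFieldType) (V : finType) (e : rel V)
    (n : nat) (beta : R) : Prop :=
  #|V| = n /\
  forall X Y : {set V},
    X \proper [set: V] -> Y \proper [set: V] -> [disjoint X & Y] ->
    (forall x y, x \in X -> y \in Y -> ~~ e x y) ->
    (#|X|%:R * #|Y|%:R) / ((n%:R - #|X|%:R) * (n%:R - #|Y|%:R)) <= beta ^+ 2.

(* Main.v *)
Require Import Defs.
From mathcomp Require Import all_boot all_order all_algebra.
From mathcomp Require Import zify ring lra.

Set Implicit Arguments.
Unset Strict Implicit.
Unset Printing Implicit Defensive.

Import Order.TTheory GRing.Theory Num.Theory.
Local Open Scope ring_scope.

(** By König's theorem there is a vertex cover [C] with [c = |C|] at most the
    matching number; if [c < |U|], its complement is an independent set of size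
    [m = n - c].  Splitting that set into two parts of (nearly) equal size [m/2]
    gives roughly [((n - c) / (n + c))^2 <= beta^2], and since
    [t|U| <= |W| < m] the claim reduces to [0 <= (m - 2c)^2 (m + c)].

    König's theorem follows by induction on the number of edges: if two edges
    [f], [g] share a vertex [x], the covers obtained for [E - f] and [E - g]
    combine with [x], by uncrossing along the bipartition, into two covers of
    [E] of which the smaller is small enough. *)

Definition crossing (V : finType) (S f : {set V}) : Prop :=
  exists u w, [/\ u \in S, w \notin S & f = [set u; w]].

Definition vertex_cover (V : finType) (E : {set {set V}}) (C : {set V}) : Prop :=
  forall f, f \in E -> ~~ [disjoint f & C].

Lemma crossingC (V : finType) (S f : {set V}) :
  crossing S f -> crossing (~: S) f.
Proof.
case=> u [w [uS wS ->]]; exists w, u.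
by rewrite !inE wS negbK uS setUC.
Qed.

Lemma meets_pair (V : finType) (u w : V) (C : {set V}) :
  ~~ [disjoint [set u; w] & C] = (u \in C) || (w \in C).
Proof.
apply/idP/idP => [/pred0Pn[z /andP[/= /set2P[]-> ->]]|]; rewrite ?orbT //.
case/orP=> h; apply/pred0Pn; [exists u | exists w];
  by rewrite /= h !inE eqxx ?orbT.
Qed.

(** Union on the side [S], intersection off it. Intersecting with [S] keeps the added [x] only when
    it lies on that side. *)
Definition uncross (V : finType) (S A B : {set V}) (x : V) : {set V} :=
  ((x |: A :|: B) :&: S) :|: (A :&: B :\: S).

(** An edge other than [f] and [g] meets both [A] and [B]: if its end in [S] lies in neither set,
    its other end lies in both. *)
Lemma uncross_cover (V : finType) (S : {set V}) (E : {set {set V}})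
    (f g A B : {set V}) (x : V) :
  (forall h, h \in E -> crossing S h) -> f != g -> f \in E -> g \in E ->
  x \in f -> x \in g ->
  vertex_cover (E :\ f) A -> vertex_cover (E :\ g) B ->
  [disjoint f & A] -> [disjoint g & B] ->
  vertex_cover E (uncross S A B x).
Proof.
move=> crE fg fE gE xf xg cA cB fA gB h hE.
have xA : x \notin A by rewrite (disjointFr fA xf).
have xB : x \notin B by rewrite (disjointFr gB xg).
have [u [w [uS wS hd]]] := crE h hE.
have inA : h != f -> (u \in A) || (w \in A).
  by move=> hf; rewrite -meets_pair -hd; apply: cA; rewrite !inE hf.
have inB : h != g -> (u \in B) || (w \in B).
  by move=> hg; rewrite -meets_pair -hd; apply: cB; rewrite !inE hg.
have hx : x \in h -> (u == x) || (w == x).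
  by rewrite hd !inE ![x == _]eq_sym.
rewrite hd meets_pair !inE uS (negPf wS) !(andbT, andbF, orbF, orFb) /=.
(* The edge [f] meets [B], but not at [x]. So either [x] is the end of [f] in [S], or the end in [S]
   belongs to [B]; the edge [g] is symmetric, with [A]. *)
have [hf|hf] := eqVneq h f.
  have := inB; rewrite hf fg => /(_ isT).
  move: hx; rewrite hf => /(_ xf) /orP[/eqP->|/eqP->]; first by rewrite eqxx.
  by rewrite (negPf xB) orbF => ->; rewrite !orbT.
have [hg|hg] := eqVneq h g.
  have := inA hf; move: hx; rewrite hg => /(_ xg) /orP[/eqP->|/eqP->].
    by rewrite eqxx.
  by rewrite (negPf xA) orbF => ->; rewrite !orbT.
move: (inA hf) (inB hg).
by case: (u \in A); case: (u \in B); rewrite ?orbT //= => -> ->; rewrite orbT.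
Qed.

(** The four pieces reassemble into [x |: A :|: B] and [A :&: B], whose sizes add up to at most
    [#|A| + #|B| + 1]. *)
Lemma card_uncross (V : finType) (S A B : {set V}) (x : V) :
  (#|uncross S A B x| + #|uncross (~: S) A B x| <= #|A| + #|B| + 1)%N.
Proof.
have h1 (T : {set V}) : (#|uncross T A B x| <=
    #|(x |: A :|: B) :&: T| + #|A :&: B :\: T|)%N.
  by rewrite cardsU leq_subr.
have := h1 S; have := h1 (~: S).
have := cardsID S (x |: A :|: B); have := cardsID S (A :&: B).
rewrite -setDE; have -> : A :&: B :\: ~: S = A :&: B :&: S by rewrite setDE setCK.
have : (#|x |: A :|: B| <= 1 + #|A :|: B|)%N.
  by rewrite -setUA cardsU1 leq_add2r; case: (_ \notin _).
have := cardsUI A B.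
lia.
Qed.

Lemma card_crossing_edge (V : finType) (S f : {set V}) :
  crossing S f -> #|f :&: S| = 1%N.
Proof.
case=> u [w [uS wS ->]]; apply/eqP/cards1P; exists u.
apply/setP=> z; rewrite !inE; case: eqVneq => [->|_]; first by rewrite uS.
by case: eqVneq => [->|//]; rewrite (negPf wS).
Qed.

Lemma not_trivIset (V : finType) (E : {set {set V}}) :
  ~~ trivIset E ->
  exists f g x, [/\ f \in E, g \in E, f != g, x \in f & x \in g].
Proof.
move=> ntE.
have [/exists_inP[f fE /exists_inP[g gE /andP[fg /pred0Pn[x /andP[xf xg]]]]]|no] :=
  boolP [exists f in E, [exists g in E, (f != g) && ~~ [disjoint f & g]]].
  by exists f, g, x.
case/trivIsetP: ntE => f g fE gE fg; apply: contraNT no => fgI.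
by apply/exists_inP; exists f => //; apply/exists_inP; exists g; rewrite ?fg.
Qed.

Lemma konig (V : finType) (S : {set V}) (E : {set {set V}}) :
  (forall f, f \in E -> crossing S f) ->
  exists (C : {set V}) (M : {set {set V}}),
    [/\ vertex_cover E C, M \subset E, trivIset M & (#|C| <= #|M|)%N].
Proof.
have [k] := ubnP #|E|; elim: k E => // k IH E ltEk crE.
(* Disjoint edges form a matching themselves, and their ends in [S] cover them. *)
have [trE|] := boolP (trivIset E).
  exists (cover [set f :&: S | f in E]), E; split => //.
  - move=> f fE; have [u [w [uS wS fd]]] := crE f fE.
    rewrite fd meets_pair; apply/orP; left.
    apply/bigcupP; exists (f :&: S); first exact: imset_f.
    by rewrite inE uS fd set21.
  - apply: leq_trans (leq_card_cover _) _.
    rewrite (eq_bigr (fun=> 1%N)) ?sum1_card ?leq_imset_card // => _ /imsetP[f fE ->].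
    exact: card_crossing_edge (crE f fE).
case/not_trivIset=> f [g [x [fE gE fg xf xg]]].
have IHD h : h \in E -> exists (C : {set V}) (M : {set {set V}}),
    [/\ vertex_cover (E :\ h) C, M \subset E, trivIset M & (#|C| <= #|M|)%N].
  move=> hE; have [||C [M [cC sM tM leCM]]] := IH (E :\ h).
  - by move: ltEk; rewrite (cardsD1 h) hE.
  - by move=> h' /setD1P[_ /crE].
  by exists C, M; split=> //; apply: subset_trans sM (subD1set _ _).
have coverD h C : vertex_cover (E :\ h) C -> ~~ [disjoint h & C] ->
    vertex_cover E C.
  by move=> cC hC h' h'E; have [->//|h'h] := eqVneq h' h; apply: cC; rewrite !inE h'h.
have [A [M [cA sM tM leAM]]] := IHD f fE.
have [B [N [cB sN tN leBN]]] := IHD g gE.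
(* If [A] meets [f], it already covers all of [E]; likewise for [B] and [g]. Uncrossing treats the
   remaining case. *)
have [fA|fA] := boolP [disjoint f & A]; last first.
  by exists A, M; split=> //; apply: coverD cA fA.
have [gB|gB] := boolP [disjoint g & B]; last first.
  by exists B, N; split=> //; apply: coverD cB gB.
have c1 := uncross_cover crE fg fE gE xf xg cA cB fA gB.
have c2 := uncross_cover (fun h hE => crossingC (crE h hE)) fg fE gE xf xg cA cB fA gB.
(* The two sizes sum to at most [2 * maxn #|M| #|N| + 1], so they cannot both exceed the maximum. *)
have [P [cP leP]] : exists P, vertex_cover E P /\ (#|P| <= maxn #|M| #|N|)%N.
  have le_sum := card_uncross S A B x.
  have [le1|lt1] := leqP #|uncross S A B x| (maxn #|M| #|N|).
    by exists (uncross S A B x).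
  by exists (uncross (~: S) A B x); split=> //; lia.
have [leMN|ltNM] := leqP #|M| #|N|.
  by exists P, N; split=> //; lia.
by exists P, M; split=> //; lia.
Qed.

Lemma exists_subset_card (V : finType) (I : {set V}) (k : nat) :
  (k <= #|I|)%N -> exists2 A : {set V}, A \subset I & #|A| = k.
Proof.
move=> lekI; exists [set:: take k (enum I)].
  by apply/subsetP=> z; rewrite inE => /mem_take; rewrite mem_enum.
rewrite cardsE; have /card_uniqP -> := take_uniq k (enum_uniq I).
by rewrite size_takel // -cardE.
Qed.

Lemma cover_le_matching_number (V : finType) (e : rel V) (U W : {set V}) :
  bipartition e U W ->
  exists2 C : {set V}, (forall x y, e x y -> (x \in C) || (y \in C))
    & (#|C| <= matching_number e)%N.
Proof.
case=> _ dUW crE; have [|C [M [cC sM tM leCM]]] := @konig V U (edge_set e).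
  move=> f /imsetP[[x y]]; rewrite inE => exy ->.
  case/orP: (crE _ _ exy) => /andP[xU yW].
    by exists x, y; rewrite xU (disjointFl dUW yW).
  by exists y, x; rewrite yW (disjointFl dUW xU) setUC.
exists C => [x y exy|].
  by rewrite -meets_pair; apply: cC; apply/imsetP; exists (x, y); rewrite ?inE.
apply: leq_trans leCM _.
by apply: (@leq_bigmax_cond _ _ (fun M : {set {set V}} => #|M|)); apply/andP.
Qed.

(** Here [s] and [r] are the sizes of the two halves, [c] that of the cover and [b] stands for
    [beta ^+ 2]. Clearing the denominator leaves a polynomial inequality. *)
Lemma split_bound (R : realFieldType) (b c s r : R) :
  0 <= c -> 0 < s -> (r = s \/ r = s + 1) -> 2 * b <= 1 ->
  (s * r) / ((r + c) * (s + c)) <= b ->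
  2 * s * (1 - 2 * b) <= c.
Proof.
move=> c0 s0 rE b1; have r0 : 0 < r by case: rE => ->; lra.
have D0 : 0 < (r + c) * (s + c) by apply: mulr_gt0; lra.
rewrite ler_pdivrMr // => leb; rewrite -(ler_pM2r D0).
(* The hypothesis eliminates [b]: its product with the denominator is at least [s * r]. *)
apply: (@le_trans _ _ (2 * s * ((r + c) * (s + c) - 2 * (s * r)))).
  rewrite -[leLHS]mulrA ler_pM2l; last lra.
  by rewrite mulrBl mul1r lerD2l lerN2 -mulrA ler_pM2l // ltr0n.
rewrite -subr_ge0.
have sq : 0 <= (s - c) ^+ 2 * (2 * s + c).
  by apply: mulr_ge0; [exact: sqr_ge0 | lra].
have sc : 0 <= s * c by apply: mulr_ge0; lra.
have s2 := sqr_ge0 s; have c2 := sqr_ge0 c; have d2 := sqr_ge0 (s - c).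
(* For [r = s] the difference is exactly [sq]; for [r = s + 1] the extra terms are nonnegative. *)
case: rE => ->.
  have -> : c * ((s + c) * (s + c)) - 2 * s * ((s + c) * (s + c) - 2 * (s * s))
    = (s - c) ^+ 2 * (2 * s + c) by ring.
  exact: sq.
have -> : c * ((s + 1 + c) * (s + c)) -
    2 * s * ((s + 1 + c) * (s + c) - 2 * (s * (s + 1)))
  = (s - c) ^+ 2 * (2 * s + c) + (s ^+ 2 + (s - c) ^+ 2 + s * c) by ring.
lra.
Qed.

Theorem theorem3p5 (R : realFieldType) (beta t : R)
    (beta_gt0 : 0 < beta) (t_ge1 : 1 <= t)
    (V : finType) (e : rel V)
    (e_sym : symmetric e) (e_irr : irreflexive e) (V_gt0 : (0 < #|V|)%N)
    (U W : {set V}) (eUW : bipartition e U W)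
    (W_ge : t * #|U|%:R <= #|W|%:R)
    (n : nat) (nE : n = (#|U| + #|W|)%N)
    (e_nb : weakly_nb_graph e n beta) :
  Num.min (t * (1 - 2 * beta ^+ 2)) 1 * #|U|%:R <= (matching_number e)%:R.
Proof.
have [C coverC leC] := cover_le_matching_number eUW.
apply: le_trans (_ : #|C|%:R <= _); last by rewrite ler_nat.
have U0 : 0 <= #|U|%:R :> R by [].
have [leUC|ltCU] := leqP #|U| #|C|.
  apply: le_trans (_ : #|U|%:R <= _); last by rewrite ler_nat.
  by rewrite -[leRHS]mul1r ler_wpM2r // ge_min lexx orbT.
apply: le_trans (_ : t * (1 - 2 * beta ^+ 2) * #|U|%:R <= _).
  by rewrite ler_wpM2r // ge_min lexx.
(* When [2 * beta ^+ 2] exceeds 1 the left side is nonpositive. *)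
have [b1|b1] := lerP (2 * beta ^+ 2) 1; last first.
  apply: le_trans (ler0n R #|C|); rewrite mulr_le0_ge0 // mulr_ge0_le0 //; lra.
have leUW : (#|U| <= #|W|)%N.
  by rewrite -(ler_nat R) (le_trans _ W_ge) // ler_peMl.
case: e_nb => cardV nb.
have cardI := cardsC C; rewrite cardV in cardI.
have oddI := odd_double_half #|~: C|.
have [|A sA cA] := @exists_subset_card _ (~: C) #|~: C|./2; first by lia.
pose B := ~: C :\: A.
have cB : #|B| = (#|~: C| - #|~: C|./2)%N by rewrite cardsD (setIidPr sA) cA.
have lt_proper (X : {set V}) : (#|X| < n)%N -> X \proper [set: V].
  by move=> ltX; rewrite properEcard subsetT cardsT cardV.
have AB : [disjoint A & B] by rewrite -setI_eq0 setIDA setDIl setDv set0I.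
have indep x y : x \in A -> y \in B -> ~~ e x y.
  move=> /(subsetP sA) + /setDP[+ _]; rewrite !inE => xC yC.
  by apply/negP=> /coverC; rewrite (negPf xC) (negPf yC).
have := nb A B (lt_proper A _) (lt_proper B _) AB indep.
have rE : #|B| = #|A| \/ #|B| = (#|A| + 1)%N.
  by rewrite cA cB; move: oddI; case: (odd _) => /=; lia.
have nAB : n = (#|A| + #|B| + #|C|)%N by lia.
(* Rounding down costs nothing: [#|C| < #|U|] gives [#|~: C|] at least [#|W| + 1], and halving loses
   at most one vertex. *)
have leW2A : (#|W| <= 2 * #|A|)%N by lia.
have A0 : (0 < #|A|)%N by lia.
move=> /(_ ltac:(lia) ltac:(lia)).
have -> : n%:R - #|A|%:R = #|B|%:R + #|C|%:R :> R by rewrite nAB !natrD; ring.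
have -> : n%:R - #|B|%:R = #|A|%:R + #|C|%:R :> R by rewrite nAB !natrD; ring.
move=> bound; apply: le_trans (split_bound _ _ _ b1 bound) => //; last first.
- by case: rE => ->; [left | right; rewrite natrD].
- by rewrite ltr0n.
(* As [1 - 2 * beta ^+ 2] is nonnegative by [b1], it remains to chain [t * #|U|], [#|W|] and
   [2 * #|A|]. *)
rewrite mulrAC ler_wpM2r ?subr_ge0 // (le_trans W_ge) //.
by rewrite -natrM ler_nat.
Qed.
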